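(* Let $\mathcal{H}$ be a separable complex Hilbert space, let $A, B \in L(\mathcal{H})$ have closed range, let $C \in L(\mathcal{H})$ and let $W \in L(\mathcal{H})^{+}$. For $X\in L(\mathcal{H})$ put $H(X)=(AXB-C)^{*}W(AXB-C)$. If $N(B)\subseteq N(A^*WC)$, then the infimum of the set $\{H(X): X \in L(\mathcal{H})\}$ (with respect to the order induced in $L(\mathcal{H})$ by the cone of positive operators) exists and $$\inf_{X \in L(\mathcal{H})}H(X)=C^*W_{/R(A)}C.$$
   Context: $L(\mathcal{H})$ is the algebra of bounded linear operators on $\mathcal{H}$ and $L(\mathcal{H})^{+}$ is the cone of positive semidefinite operators. $R(T)$ and $N(T)$ denote the range and the nullspace of $T$. The order induced by the cone is: $S\le T$ if $T-S\in L(\mathcal{H})^{+}$. The infimum is the greatest lower bound in this order. For $W\in L(\mathcal{H})^{+}$ and a closed subspace $\mathcal{S}\subseteq \mathcal{H}$, the shorted operator of $W$ to $\mathcal{S}$ is $$W_{/\mathcal{S}}=\max \{ X \in L(\mathcal{H}): \ 0\leq X\leq W \mbox{ and } R(X)\subseteq \mathcal{S}^{\perp}\},$$ where the maximum is with respect to the order above (it is known that this maximum always exists). *)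

(* Defs.v *)
From HB Require Import structures.
From mathcomp Require Import all_boot all_order all_algebra.
From mathcomp Require Import complex.
From mathcomp Require Import all_classical all_reals all_analysis.

Set Implicit Arguments.
Unset Strict Implicit.
Unset Printing Implicit Defensive.

Import Order.TTheory GRing.Theory Num.Theory.
Import numFieldNormedType.Exports.

Local Open Scope classical_set_scope.
Local Open Scope ring_scope.
Local Open Scope complex_scope.

(* A complex Hilbert space is a Banach space over R[i] whose norm comes from a
   positive definite hermitian form. *)
HB.mixin Record isHilbert (R : realType) H
    of CompleteNormedModule R[i] H := {
  inner : {dot H for (@Num.conj R[i])};
  inner_norm : forall x : H, inner x x = `|x| ^+ 2
}.

#[short(type="hilbertType")]
HB.structure Definition Hilbert (R : realType) :=
  { H of CompleteNormedModule R[i] H & isHilbert R H }.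

(* Linear in the first argument, conjugate-linear in the second one. *)
Local Notation "''[' x , y ]" := (inner x y) : ring_scope.

Definition separable (T : topologicalType) : Prop :=
  exists D : set T, countable D /\ dense D.

Section Operators.
Context {R : realType} {H : hilbertType R}.
Implicit Types (S T W X : H -> H) (V : set H) (E : set (H -> H)).

(* L(H), as a set of functions; sums and differences are pointwise, the product
   is the composition [\o]. *)
Definition Lop : set (H -> H) :=
  [set T | linear T /\ bounded_near T (nbhs (0 : H))].

(* As usual in complex spaces, self-adjointness is not required separately:
   [0 <= z] in R[i] says that z is real and nonnegative. *)
Definition Lpos : set (H -> H) :=
  [set T | Lop T /\ forall x, 0 <= '[T x, x]].

Definition le_op S T : Prop := Lpos (T - S).

Definition is_opmax E T : Prop := E T /\ forall S, E S -> le_op S T.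

Definition is_opinf E T : Prop :=
  [/\ Lop T,
      forall S, E S -> le_op T S &
      forall D, Lop D -> (forall S, E S -> le_op D S) -> le_op D T].

(* The default value 0 of [xget] is only taken outside of [Lop]. *)
Definition adjoint T : H -> H :=
  xget 0 [set S | Lop S /\ forall x y, '[T x, y] = '[x, S y]].

Definition nullspace T : set H := [set x | T x = 0].

Definition orthocomp V : set H := [set x | forall y, V y -> '[x, y] = 0].

(* The shorted operator of W to V; the maximum exists, and the default value 0
   of [xget] is irrelevant, when W is positive and V is a closed subspace. *)
Definition shorted W V : H -> H :=
  xget 0 (is_opmax [set X | [/\ Lop X, le_op 0 X, le_op X W &
                                 range X `<=` orthocomp V]]).

End Operators.

(* Main.v *)
(* Let w(x) = <W x, x> and let V = R(A). For fixed x the functional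
   s |-> w(s) - 2 Re <W x, s> is bounded below on V, and a minimising sequence
   u_n is Cauchy for the seminorm sqrt w. Since |W y|^2 <= M w(y), the vectors
   W u_n converge, although the u_n need not. With z = lim W u_n,
   the map K x = W x - z is linear, takes its values in the orthogonal of V and satisfies
     <K x, x> = inf_{s in V} w(x - s).
   If 0 <= X <= W and R(X) is orthogonal to V, then X vanishes on V and
   <X x, x> = <X (x - s), x - s> <= w(x - s), so K is the shorted operator. The
   same minimisation with W = 1 is the Riesz theorem, which gives the adjoints.
   The infimum is then computed one vector x at a time: if B x <> 0, rank one
   operators X make A X B x an arbitrary element of V; if B x = 0, the
   hypothesis makes W C x orthogonal to V, so that s = 0 already minimises
   w(C x - s). *)
From HB Require Import structures.
Require Import Defs.
From mathcomp Require Import all_boot all_order all_algebra.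
From mathcomp Require Import complex ring lra.
From mathcomp Require Import all_classical all_reals all_analysis.
Import Order.TTheory GRing.Theory Num.Theory.
Import numFieldNormedType.Exports.
Local Open Scope classical_set_scope.
Local Open Scope ring_scope.

(** Discriminant criterion, read off at the minimiser [t = - b / c]. If [c = 0], the expression is
    affine in [t] and would take the value -1 unless [b = 0]. *)
Lemma quadratic_ge0 (F : realFieldType) (a b c : F) :
  0 <= c -> (forall t, 0 <= a + 2 * t * b + t ^+ 2 * c) -> b ^+ 2 <= a * c.
Proof.
rewrite le0r => /orP[/eqP c0|c0] q; last first.
- have := q (- b / c).
  have -> : a + 2 * (- b / c) * b + (- b / c) ^+ 2 * c = a - b ^+ 2 / c.
    by field; rewrite gt_eqF.
  by rewrite subr_ge0 ler_pdivrMr.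
- rewrite c0 mulr0; have [->|b0] := eqVneq b 0; first by rewrite expr0n.
  have := q (- (a + 1) / (2 * b)); rewrite c0.
  have -> : a + 2 * (- (a + 1) / (2 * b)) * b +
    (- (a + 1) / (2 * b)) ^+ 2 * 0 = -1 by field; rewrite b0.
  by rewrite lerNr oppr0 ler10.
Qed.

(** * Real inner product and norm *)

Section RealInnerProduct.

Set Implicit Arguments.
Unset Strict Implicit.
Unset Printing Implicit Defensive.
Local Open Scope complex_scope.
Context {R : realType} {H : hilbertType R}.
Implicit Types (x y z : H) (a : R) (c : R[i]).

(** Real values make ordered-field reasoning available; the imaginary part of [inner x y] is
    recovered as [rdot x ('i *: y)]. *)
Definition rdot x y : R := complex.Re (inner x y).
Definition rnorm x : R := complex.Re `|x|.

Lemma innerC x y : inner x y = (inner y x)^*.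
Proof. by rewrite hermC /= expr0 mul1r. Qed.

Lemma rdotC x y : rdot x y = rdot y x.
Proof. by rewrite /rdot innerC; case: (inner y x). Qed.

Lemma rdotDl x y z : rdot (x + y) z = rdot x z + rdot y z.
Proof. by rewrite /rdot linearDl raddfD. Qed.

Lemma rdotNl x z : rdot (- x) z = - rdot x z.
Proof. by rewrite /rdot linearNl raddfN. Qed.

Lemma rdotBl x y z : rdot (x - y) z = rdot x z - rdot y z.
Proof. by rewrite rdotDl rdotNl. Qed.

Lemma rdotZl a x z : rdot (a%:C *: x) z = a * rdot x z.
Proof. by rewrite /rdot linearZl_LR /=; case: (inner x z) => u v /=; ring. Qed.

Lemma rdotDr x y z : rdot z (x + y) = rdot z x + rdot z y.
Proof. by rewrite !(rdotC z) rdotDl. Qed.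

Lemma rdotNr x z : rdot z (- x) = - rdot z x.
Proof. by rewrite !(rdotC z) rdotNl. Qed.

Lemma rdotBr x y z : rdot z (x - y) = rdot z x - rdot z y.
Proof. by rewrite !(rdotC z) rdotBl. Qed.

Lemma rdotZr a x z : rdot z (a%:C *: x) = a * rdot z x.
Proof. by rewrite !(rdotC z) rdotZl. Qed.

Lemma rdotZlr c x y : rdot (c *: x) y = rdot x (c^* *: y).
Proof. by rewrite /rdot linearZl_LR linearZr_LR /= conjCK. Qed.

Lemma innerE x y : inner x y = rdot x y +i* rdot x ('i *: y).
Proof.
rewrite /rdot linearZr_LR /=; case: (inner x y) => u v /=.
by congr Complex; ring.
Qed.

Lemma rnorm_ge0 x : 0 <= rnorm x.
Proof. by have := normr_ge0 x; rewrite lecE => /andP[]. Qed.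

Lemma normE x : `|x| = (rnorm x)%:C.
Proof. by rewrite /rnorm RRe_real // normr_real. Qed.

Lemma rdotxx x : rdot x x = rnorm x ^+ 2.
Proof. by rewrite /rdot inner_norm normE -rmorphXn. Qed.

Lemma rnorm0_eq0 x : rnorm x = 0 -> x = 0.
Proof. by move=> x0; apply/normr0_eq0; rewrite normE x0. Qed.

Lemma rnormD x y : rnorm (x + y) <= rnorm x + rnorm y.
Proof. by have := ler_normD x y; rewrite !normE -rmorphD lecR. Qed.

Lemma rnormN x : rnorm (- x) = rnorm x.
Proof. by rewrite /rnorm normrN. Qed.

Lemma complex_normE c : `|c| = (complex.Re `|c|)%:C.
Proof. by rewrite RRe_real // normr_real. Qed.

Lemma rnormZ c x : rnorm (c *: x) = complex.Re `|c| * rnorm x.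
Proof.
apply: complexI; have := normrZ c x; rewrite !normE => ->.
by rewrite {1}[`|c|]complex_normE rmorphM.
Qed.

Lemma inner_eq x y x' y' :
  rdot x y = rdot x' y' -> rdot x ('i *: y) = rdot x' ('i *: y') ->
  inner x y = inner x' y'.
Proof. by rewrite !innerE => -> ->. Qed.

Lemma rdot_inj y z : (forall x, rdot x y = rdot x z) -> y = z.
Proof.
move=> yz; apply/eqP; rewrite -subr_eq0; apply/eqP/rnorm0_eq0/eqP.
by rewrite -sqrf_eq0 -rdotxx rdotBr yz subrr.
Qed.

(** * Linear and bounded maps *)

Section LinearMap.
Context {T : H -> H} (lT : linear T).

Lemma linmB x y : T (x - y) = T x - T y.
Proof. exact: (GRing.zmod_morphism_linear lT). Qed.

Lemma linmZ c x : T (c *: x) = c *: T x.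
Proof. exact: (GRing.scalable_linear lT). Qed.

Lemma linm0 : T 0 = 0.
Proof. by have := linmB 0 0; rewrite !subrr. Qed.

Lemma linmN x : T (- x) = - T x.
Proof. by rewrite -sub0r linmB linm0 sub0r. Qed.

Lemma linmD x y : T (x + y) = T x + T y.
Proof. by rewrite -{1}[y]opprK linmB linmN opprK. Qed.

End LinearMap.

Lemma LopP (T : H -> H) : Lop T <->
  linear T /\ exists2 M, 0 <= M & forall x, rnorm (T x) <= M * rnorm x.
Proof.
split=> -[lT bT]; split=> //.
  pose T' : {linear H -> H} :=
    HB.pack T (GRing.isLinear.Build _ _ _ _ T lT).
  have /linear_boundedP/pinfty_ex_gt0 [M M0 MT] :
    bounded_near T' (nbhs 0) by [].
  exists (complex.Re M) => [|x].
    by have := ltW M0; rewrite lecE => /andP[].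
  have MR : M = (complex.Re M)%:C by rewrite RRe_real // gtr0_real.
  by have := MT x; rewrite !normE MR -rmorphM lecR.
case: bT => M M0 MT.
pose T' : {linear H -> H} :=
  HB.pack T (GRing.isLinear.Build _ _ _ _ T lT).
suff : bounded_near T' (nbhs 0) by [].
apply/linear_boundedP; exists M%:C; split; first by rewrite complex_real.
move=> c /ltW cM x; apply: le_trans (ler_wpM2r (normr_ge0 x) cM).
by rewrite !normE -rmorphM lecR.
Qed.

(** * Positive operators and their seminorms *)

Section PositiveMap.
Context (W : H -> H) (lW : linear W) (W0 : forall x, 0 <= inner (W x) x).

(** Polarization: [<W z, z>] is real for every [z], and the imaginary part at [z = x + i y] consists
    of the two cross terms only. *)
Lemma pos_sym x y : rdot (W x) y = rdot (W y) x.
Proof.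
have im0 z : rdot (W z) ('i *: z) = 0.
  by have := W0 z; rewrite innerE lecE => /andP[/eqP].
have := im0 (x + 'i *: y).
rewrite (linmD lW) (linmZ lW) scalerDr scalerA -expr2 sqr_i scaleN1r.
rewrite rdotDl !rdotDr !rdotNr im0 rdotZlr scalerA rdotZlr.
have -> : (('i : R[i])^* = - 'i)%R.
  by apply/eqP; rewrite eq_complex /= oppr0 !eqxx.
rewrite scaleNr rdotNr im0 mulNr -expr2 sqr_i opprK scale1r.
by move=> ?; lra.
Qed.

Lemma pos_ge0 x : 0 <= rdot (W x) x.
Proof. by have := W0 x; rewrite innerE lecE => /andP[]. Qed.

(** The seminorm [|W^(1/2) x|], written without a square root of [W]. *)
Definition wnorm x := Num.sqrt (rdot (W x) x).

Lemma wnorm_ge0 x : 0 <= wnorm x. Proof. exact: sqrtr_ge0. Qed.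

Lemma wnorm_sqr x : wnorm x ^+ 2 = rdot (W x) x.
Proof. by rewrite sqr_sqrtr // pos_ge0. Qed.

Lemma wnormZ c x : wnorm (c *: x) = complex.Re `|c| * wnorm x.
Proof.
have cc : c^* * c = ((complex.Re `|c|) ^+ 2)%:C.
  by rewrite mulrC -normCK {1}[`|c|]complex_normE -rmorphXn.
rewrite /wnorm (linmZ lW) rdotZlr scalerA cc rdotZr.
rewrite sqrtrM ?sqr_ge0 // sqrtr_sqr ger0_norm //.
by have := normr_ge0 c; rewrite lecE => /andP[].
Qed.

Lemma wnormN x : wnorm (- x) = wnorm x.
Proof. by rewrite -scaleN1r wnormZ normrN1 mul1r. Qed.

Lemma wnormZr (a : R) x : wnorm (a%:C *: x) = `|a| * wnorm x.
Proof. by rewrite wnormZ normc_def /= expr0n /= addr0 sqrtr_sqr. Qed.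

Lemma pos_expand x y :
  wnorm (x + y) ^+ 2 = wnorm x ^+ 2 + 2 * rdot (W x) y + wnorm y ^+ 2.
Proof. 
by rewrite !wnorm_sqr (linmD lW) rdotDl !rdotDr (pos_sym y x); ring.
Qed.

Lemma pos_CS x y : `|rdot (W x) y| <= wnorm x * wnorm y.
Proof.
rewrite -ler_sqr ?nnegrE ?mulr_ge0 ?wnorm_ge0 // real_normK ?num_real // exprMn.
apply: quadratic_ge0 => [|t]; first exact: sqr_ge0.
have := sqr_ge0 (wnorm (x + t%:C *: y)).
by rewrite pos_expand rdotZr wnormZr exprMn real_normK ?num_real // mulrA.
Qed.

End PositiveMap.

Lemma inner_ge0 x : 0 <= inner x x.
Proof. by rewrite inner_norm exprn_ge0. Qed.

Lemma id_linear : linear (@id H). Proof. by []. Qed.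

Lemma wnorm_id x : wnorm id x = rnorm x.
Proof. by rewrite /wnorm rdotxx sqrtr_sqr ger0_norm ?rnorm_ge0. Qed.

Lemma rdot_CS x y : `|rdot x y| <= rnorm x * rnorm y.
Proof. by rewrite -!wnorm_id (pos_CS id_linear inner_ge0). Qed.

(** Translates completeness from Cauchy filters with radii in [R[i]] to sequences with radii in
    [R]. *)
Lemma complete_seq (v : nat -> H) :
  (forall e : R, 0 < e -> exists N, forall n k, (N <= n)%N -> (N <= k)%N ->
    rnorm (v n - v k) <= e) ->
  exists z, forall e : R, 0 < e -> exists N, forall n, (N <= n)%N ->
    rnorm (v n - z) <= e.
Proof.
move=> cv.
have real_pos (c : R[i]) : 0 < c -> exists2 e : R, 0 < e & c = e%:C.
  move=> c0; have cE : c = (complex.Re c)%:C by rewrite RRe_real // gtr0_real.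
  by exists (complex.Re c); rewrite // -ltcR -cE.
have /cauchy_cvgP/cvg_ex[z vz] : cauchy (v @ \oo).
  apply/cauchy_exP => c /real_pos[e e0 ->].
  have [N vN] := cv (e / 2) ltac:(by rewrite divr_gt0).
  exists (v N); exists N => // n /= Nn; rewrite -ball_normE /=.
  rewrite normE ltcR (le_lt_trans (vN _ _ (leqnn N) Nn)) //.
  by rewrite ltr_pdivrMr // ltr_pMr // ltr1n.
exists z => e e0.
have /cvgrPdist_le/(_ e%:C) := vz.
rewrite ltcR => /(_ e0)[N _ Nz]; exists N => n /Nz /=.
by rewrite distrC normE lecR.
Qed.

(** * Approximate projections for a seminorm *)

Section Bounded.
Context (W : H -> H) (lW : linear W) (W0 : forall x, 0 <= inner (W x) x).
Context (M : R) (M0 : 0 <= M) (WM : forall x, rdot (W x) x <= M * rnorm x ^+ 2).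

Lemma wnorm_le_rnorm x : wnorm W x <= Num.sqrt M * rnorm x.
Proof.
rewrite -ler_sqr ?nnegrE ?mulr_ge0 ?sqrtr_ge0 ?wnorm_ge0 ?rnorm_ge0 //.
by rewrite wnorm_sqr // exprMn sqr_sqrtr.
Qed.

(* |W x|^2 = <W x, W x> <= w(x)^(1/2) w(W x)^(1/2) and w(W x) <= M |W x|^2 *)
Lemma rnorm_le_wnorm x : rnorm (W x) <= Num.sqrt M * wnorm W x.
Proof.
have [/eqP|Wx0] := eqVneq (rnorm (W x)) 0.
  by move/eqP->; rewrite mulr_ge0 ?sqrtr_ge0 ?wnorm_ge0.
have Wx_gt0 : 0 < rnorm (W x) by rewrite lt_def Wx0 rnorm_ge0.
rewrite -(ler_pM2r Wx_gt0) -expr2 -rdotxx.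
rewrite (le_trans (ler_norm _)) // (le_trans (pos_CS lW W0 _ _)) //.
by rewrite mulrAC [leRHS]mulrC ler_wpM2l ?wnorm_ge0 ?wnorm_le_rnorm.
Qed.

Lemma rnorm_pos_le x : rnorm (W x) <= M * rnorm x.
Proof.
rewrite (le_trans (rnorm_le_wnorm _)) // -[in leRHS](sqr_sqrtr M0) expr2 -mulrA.
by rewrite ler_wpM2l ?sqrtr_ge0 ?wnorm_le_rnorm.
Qed.

(* [u] is a [d]-approximate projection onto [V], for the seminorm [wnorm W], of
   the vector that represents [g]. Unlike near-minimality, this condition is
   linear in [(u, g)]. *)
Definition near_proj (V : set H) (g : H -> R) (d : R) u :=
  V u /\ forall s, V s -> `|rdot (W u) s - g s| <= d * wnorm W s.

(** Both conditions are tested at [s = u - v]: the terms in [g] cancel, and one factor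
    [wnorm W (u - v)] is divided out. *)
Lemma near_proj_dist V g d d' u v : 0 <= d -> 0 <= d' -> V (u - v) ->
  near_proj V g d u -> near_proj V g d' v -> wnorm W (u - v) <= d + d'.
Proof.
move=> d0 d'0 Vuv [_ /(_ _ Vuv) hu] [_ /(_ _ Vuv) hv].
have [->|w0] := eqVneq (wnorm W (u - v)) 0; first exact: addr_ge0.
have {w0} w0 : 0 < wnorm W (u - v) by rewrite lt_def w0 wnorm_ge0.
rewrite -(ler_pM2r w0) -expr2 (wnorm_sqr W0) {1}(linmB lW) rdotBl mulrDl.
move: hu hv; rewrite !ler_norml => /andP[_ hu] /andP[hv _]; lra.
Qed.

(** Near-minimisers of [w(s) - 2 g(s)] on [V] are approximate projections; their images under [W]
    are Cauchy by [near_proj_dist] and [rnorm_le_wnorm]. *)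
Lemma near_proj_exists (V : set H) (g : H -> R) (G : R) :
  V 0 -> (forall a x y, V x -> V y -> V (a%:C *: x + y)) ->
  (forall a x y, g (a%:C *: x + y) = a * g x + g y) ->
  (forall s, V s -> `|g s| <= G * wnorm W s) ->
  exists z, forall d : R, 0 < d ->
    exists2 u, rnorm (W u - z) <= d & near_proj V g d u.
Proof.
move=> V0 VD gD gG.
pose phi s := wnorm W s ^+ 2 - 2 * g s.
have phi_lb : has_lbound (phi @` V).
  (* Completing the square in [wnorm W s]. *)
  exists (- G ^+ 2) => _ [s /gG gs <-]; rewrite /phi.
  have := sqr_ge0 (wnorm W s - G); rewrite sqrrB.
  by move: gs; rewrite ler_norml => /andP[_]; lra.
have phi_inf : has_inf (phi @` V) by split => //; exists (phi 0), 0.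
have np d : 0 < d -> exists u, near_proj V g d u.
  move=> d0; have d20 : 0 < d ^+ 2 by rewrite exprn_gt0.
  (* The accuracy is [d ^+ 2] because comparing [phi u] with [phi (t s + u)] for all real [t] bounds
     the square of the defect. *)
  have [_ [u Vu <-] phiu] := inf_adherent d20 phi_inf.
  exists u; split => // s Vs.
  rewrite -ler_sqr ?nnegrE ?mulr_ge0 ?wnorm_ge0 ?(ltW d0) //.
  rewrite real_normK ?num_real // exprMn; apply: quadratic_ge0 => [|t]; first exact: sqr_ge0.
  have := ge_inf phi_lb (imageP phi (VD t _ _ Vs Vu)).
  rewrite /phi gD [_ + u]addrC pos_expand // rdotZr wnormZr //.
  rewrite exprMn real_normK ?num_real //.
  by move: phiu; rewrite /phi; lra.
have /choice[u hu] n : exists u, near_proj V g n.+1%:R^-1 u.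
  by apply: np; rewrite invr_gt0 ltr0n.
have Vuu n k : V (u n - u k).
  have := VD (-1) _ _ (hu k).1 (hu n).1.
  by rewrite rmorphN rmorph1 scaleN1r addrC.
have uu n k :
    rnorm (W (u n) - W (u k)) <= Num.sqrt M * (n.+1%:R^-1 + k.+1%:R^-1).
  rewrite -(linmB lW) (le_trans (rnorm_le_wnorm _)) // ler_wpM2l ?sqrtr_ge0 //.
  by apply: (near_proj_dist (g := g)) (hu n) (hu k) => //; rewrite invr_ge0.
have inv_small (e : R) : 0 < e ->
    exists N, forall n, (N <= n)%N -> n.+1%:R^-1 <= e.
  move=> e0; have [N _ hN] := near_infty_natSinv_lt (PosNum e0).
  by exists N => n /hN /ltW.
have [z hz] : exists z, forall e : R, 0 < e -> exists N, forall n, (N <= n)%N ->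
    rnorm (W (u n) - z) <= e.
  apply: complete_seq => e e0.
  (* [Num.sqrt M] may be 0, so 1 is added before dividing. *)
  have sM : 0 < Num.sqrt M + 1 by rewrite ltr_wpDl ?sqrtr_ge0.
  have [|N hN] := inv_small (e / (2 * (Num.sqrt M + 1))).
    by rewrite divr_gt0 ?mulr_gt0.
  exists N => n k /hN hn /hN hk; apply: (le_trans (uu n k)).
  apply: (@le_trans _ _ ((Num.sqrt M + 1) * (n.+1%:R^-1 + k.+1%:R^-1))).
    by rewrite ler_wpM2r ?addr_ge0 ?invr_ge0 // lerDl.
  rewrite -ler_pdivlMl //; apply: le_trans (lerD hn hk) _.
  by rewrite le_eqVlt; apply/orP; left; apply/eqP; field; rewrite gt_eqF.
exists z => d d0; have [N1 h1] := hz d d0; have [N2 h2] := inv_small d d0.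
pose n := maxn N1 N2; exists (u n); first by apply: h1; rewrite leq_maxl.
have [Vn hn] := hu n; split => // s Vs; apply: (le_trans (hn s Vs)).
by rewrite ler_wpM2r ?wnorm_ge0 // h2 // leq_maxr.
Qed.

End Bounded.

(** Stands for a limit [d -> 0]; the restriction [d <= 1] admits error bounds that are linear in [d]
    only for small [d]. *)
Lemma le0_small (a b : R) :
  (forall d, 0 < d -> d <= 1 -> a <= d * b) -> a <= 0.
Proof.
move=> ab; rewrite leNgt; apply/negP => a0.
have b0 : 0 < b.
  by have := ab 1 ltr01 (lexx 1); rewrite mul1r; exact: lt_le_trans.
have ab0 : 0 < a + b by rewrite addr_gt0.
have := ab (a / (2 * (a + b))); rewrite divr_gt0 ?mulr_gt0 // => /(_ isT).
rewrite ler_pdivrMr ?mulr_gt0 // mul1r => /(_ ltac:(lra)).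
rewrite mulrAC ler_pdivlMr ?mulr_gt0 // ler_pM2l //; lra.
Qed.

Lemma eq0_small (a b : R) :
  (forall d, 0 < d -> d <= 1 -> `|a| <= d * b) -> a = 0.
Proof. by move=> /le0_small; rewrite normr_le0 => /eqP. Qed.

(** The errors of [u] vanish with [d], so the limit [z] represents [g] exactly on [V], even if no
    single [u] does. *)
Lemma near_proj_lim (W : H -> H) (V : set H) (g : H -> R) z :
  (forall d : R, 0 < d ->
    exists2 u, rnorm (W u - z) <= d & near_proj W V g d u) ->
  forall s, V s -> rdot z s = g s.
Proof.
move=> hz s Vs; apply/eqP; rewrite -subr_eq0; apply/eqP.
apply: (@eq0_small _ (rnorm s + wnorm W s)) => d d0 _.
have [u uz [_ /(_ s Vs) ug]] := hz d d0.
have -> : rdot z s - g s = (rdot (W u) s - g s) - rdot (W u - z) s.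
  by rewrite rdotBl; ring.
rewrite (le_trans (ler_normB _ _)) // addrC mulrDr lerD //.
by rewrite (le_trans (rdot_CS _ _)) // ler_wpM2r ?rnorm_ge0.
Qed.

(** * Adjoints and the algebra of bounded operators *)

Lemma adjoint_exists (T : H -> H) : Lop T ->
  exists S, Lop S /\ forall x y, inner (T x) y = inner x (S y).
Proof.
move=> /LopP[lT [M M0 TM]].
have /choice[S hS] y : exists z, forall x, rdot (T x) y = rdot x z.
  have id1 x : rdot (id x) x <= 1 * rnorm x ^+ 2 by rewrite mul1r rdotxx.
  (* Riesz: with [W = 1] and [V] the whole space, [z] represents [x |-> Re <T x, y>]. *)
  have [||||z /near_proj_lim hz] := @near_proj_exists id id_linear inner_ge0
    1 ler01 id1 setT (fun x => rdot (T x) y) (M * rnorm y).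
  - by [].
  - by [].
  - by move=> a x x'; rewrite (linmD lT) (linmZ lT) rdotDl rdotZl.
  - move=> s _; rewrite wnorm_id (le_trans (rdot_CS _ _)) // mulrAC.
    by rewrite ler_wpM2r ?rnorm_ge0.
  by exists z => x; rewrite [RHS]rdotC hz.
(* Moving ['i] to the first argument, where [T] is linear, yields the imaginary part as well. *)
have hSi x y : rdot (T x) ('i *: y) = rdot x ('i *: S y).
  have tr u v : rdot u ('i *: v) = rdot ('i^* *: u) v by rewrite rdotZlr conjCK.
  by rewrite !tr -(linmZ lT) hS.
have hSc x y : inner (T x) y = inner x (S y) by apply: inner_eq.
exists S; split=> //; apply/LopP; split.
  move=> c x y; apply: rdot_inj => z; rewrite -hS !rdotDr -!hS.
  by rewrite -[in LHS](conjCK c) -rdotZlr -(linmZ lT) hS rdotZlr conjCK.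
exists M => // x; have [->|Sx0] := eqVneq (rnorm (S x)) 0.
  by rewrite mulr_ge0 ?rnorm_ge0.
have {Sx0} Sx0 : 0 < rnorm (S x) by rewrite lt_def Sx0 rnorm_ge0.
rewrite -(ler_pM2r Sx0) -expr2 -rdotxx -hS (le_trans (ler_norm _)) //.
by rewrite (le_trans (rdot_CS _ _)) // mulrAC ler_wpM2r ?rnorm_ge0.
Qed.

Lemma adjointP (T : H -> H) : Lop T ->
  Lop (adjoint T) /\ forall x y, inner (T x) y = inner x (adjoint T y).
Proof. by move=> /adjoint_exists exS; exact: (xgetPex 0 exS). Qed.

Lemma LopB (S T : H -> H) : Lop S -> Lop T -> Lop (S - T).
Proof.
move=> /LopP[lS [M M0 SM]] /LopP[lT [N N0 TN]]; apply/LopP; split.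
  move=> c x y; rewrite !fctE lS lT scalerBr !opprD !addrA.
  by congr (_ + _); rewrite addrAC.
exists (M + N) => [|x]; first exact: addr_ge0.
by rewrite !fctE (le_trans (rnormD _ _)) // rnormN mulrDl lerD.
Qed.

Lemma Lop_comp (S T : H -> H) : Lop S -> Lop T -> Lop (S \o T).
Proof.
move=> /LopP[lS [M M0 SM]] /LopP[lT [N N0 TN]]; apply/LopP; split.
  by move=> c x y; rewrite /= lT lS.
exists (M * N) => [|x]; first exact: mulr_ge0.
by rewrite /= (le_trans (SM _)) // -mulrA ler_wpM2l.
Qed.

(** Supplies, in the final argument, operators [X] that send [B x] to a prescribed vector. *)
Lemma rank_one_Lop y z : Lop (fun x => inner x y *: z).
Proof.
apply/LopP; split.
  by move=> c u v; rewrite linearDl linearZl_LR /= scalerDl scalerA.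
exists ((rnorm y + rnorm ('i *: y)) * rnorm z) => [|x].
  by rewrite mulr_ge0 ?addr_ge0 ?rnorm_ge0.
have sqrt_le (a b : R) : Num.sqrt (a ^+ 2 + b ^+ 2) <= `|a| + `|b|.
  rewrite -ler_sqr ?nnegrE ?addr_ge0 ?sqrtr_ge0 //.
  rewrite sqr_sqrtr ?addr_ge0 ?sqr_ge0 //.
  rewrite sqrrD !real_normK ?num_real // lerD2r lerDl.
  by rewrite mulrn_wge0 // mulr_ge0.
rewrite rnormZ normc_def innerE /= mulrAC ler_wpM2r ?rnorm_ge0 //.
by rewrite (le_trans (sqrt_le _ _)) // mulrC mulrDr lerD // rdot_CS.
Qed.

Lemma inner_ge0E x y :
  (0 <= inner x y) = (rdot x ('i *: y) == 0) && (0 <= rdot x y).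
Proof. by rewrite innerE lecE. Qed.

(** * The shorted operator *)

Definition subspace (V : set H) :=
  V 0 /\ forall c x y, V x -> V y -> V (c *: x + y).

Section Shorted.
Context (W : H -> H) (LW : Lpos W) (V : set H) (sV : subspace V).

Let lW : linear W. Proof. by case: LW => -[]. Qed.

Let W0 : forall x, 0 <= inner (W x) x. Proof. by case: LW. Qed.

Let W_bound : exists2 M, 0 <= M & forall x, rdot (W x) x <= M * rnorm x ^+ 2.
Proof.
case: LW => /LopP[_ [M M0 WM]] _; exists M => // x.
rewrite (le_trans (ler_norm _)) // (le_trans (rdot_CS _ _)) //.
by rewrite expr2 mulrA ler_wpM2r ?rnorm_ge0.
Qed.

Lemma subspaceZ c x : V x -> V (c *: x).
Proof.
by move=> Vx; rewrite -[_ *: _]addr0; apply: sV.2 => //; exact: sV.1.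
Qed.

Lemma subspaceB x y : V x -> V y -> V (x - y).
Proof. by move=> Vx Vy; rewrite addrC -scaleN1r; apply: sV.2. Qed.

(* [z] is the limit of the [W u], for approximate projections [u] of [x] on [V];
   the projection itself need not exist. *)
Definition is_wproj x z := forall d : R, 0 < d ->
  exists2 u, rnorm (W u - z) <= d & near_proj W V (rdot (W x)) d u.

Lemma is_wproj_exists x : exists z, is_wproj x z.
Proof.
have [M M0 WM] := W_bound.
apply: (@near_proj_exists W lW W0 M M0 WM V (rdot (W x)) (wnorm W x)).
- exact: sV.1.
- by move=> a; exact: sV.2.
- by move=> a u v; rewrite rdotDr rdotZr.
- by move=> s _; exact: pos_CS.
Qed.

(** Approximate projections for the two limits are within [2 d] in the seminorm, hence their images
    under [W] are within [2 d sqrt M]. *)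
Lemma is_wproj_unique x z z' : is_wproj x z -> is_wproj x z' -> z = z'.
Proof.
move=> hz hz'; have [M M0 WM] := W_bound.
apply/eqP; rewrite -subr_eq0; apply/eqP/rnorm0_eq0.
apply: (@eq0_small _ (2 + 2 * Num.sqrt M)) => d d0 _.
have [u uz pu] := hz d d0; have [v vz pv] := hz' d d0.
rewrite ger0_norm ?rnorm_ge0 //.
have -> : z - z' = (W v - z') + (W (u - v) - (W u - z)).
  by rewrite (linmB lW) opprB [W u - _ + _]addrC [RHS]addrC !subrKA.
have Vuv : V (u - v) by apply: subspaceB; [case: pu | case: pv].
have := near_proj_dist lW W0 (ltW d0) (ltW d0) Vuv pu pv.
move/(ler_wpM2l (sqrtr_ge0 M)).
have := rnorm_le_wnorm lW W0 M0 WM (u - v).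
have := rnormD (W v - z') (W (u - v) - (W u - z)).
have := rnormD (W (u - v)) (- (W u - z)); rewrite rnormN.
by move: uz vz; lra.
Qed.

(** Approximate projections combine linearly; tolerance [e] for each gives the total error
    [|c| e + e = d]. *)
Lemma is_wproj_linear c x y z z' : is_wproj x z -> is_wproj y z' ->
  is_wproj (c *: x + y) (c *: z + z').
Proof.
move=> hz hz' d d0.
pose k := complex.Re `|c|; have k0 : 0 <= k.
  by have := normr_ge0 c; rewrite lecE => /andP[].
have k1 : 0 < k + 1 by rewrite ltr_wpDl.
pose e := d / (k + 1); have e0 : 0 < e by rewrite divr_gt0.
have de : d = k * e + e by rewrite /e; field; rewrite gt_eqF.
have [u uz [Vu pu]] := hz e e0; have [v vz [Vv pv]] := hz' e e0.
exists (c *: u + v).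
  rewrite lW opprD addrACA -scalerBr (le_trans (rnormD _ _)) // rnormZ de.
  by rewrite lerD // ler_wpM2l.
split=> [|s Vs]; first exact: sV.2.
rewrite !lW !rdotDl !rdotZlr opprD addrACA (le_trans (ler_normD _ _)) //.
rewrite de mulrDl lerD ?pv // (le_trans (pu _ (subspaceZ _ Vs))) //.
by rewrite wnormZ // norm_conjC mulrCA mulrA.
Qed.

Definition wproj x := xget 0 (is_wproj x).

Lemma wprojP x : is_wproj x (wproj x).
Proof. exact: (xgetPex 0 (is_wproj_exists x)). Qed.

(** Equals [W^(1/2) (1 - P) W^(1/2)], with [P] the orthogonal projection onto the closure of
    [W^(1/2) V]. *)
Definition wshort x := W x - wproj x.

Lemma wshort_linear : linear wshort.
Proof.
move=> c x y; rewrite /wshort lW scalerBr addrACA -opprD; congr (_ - _).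
apply: is_wproj_unique (wprojP _) _.
exact: is_wproj_linear (wprojP _) (wprojP _).
Qed.

Lemma wshort_orth x s : V s -> rdot (wshort x) s = 0.
Proof.
by move=> Vs; rewrite rdotBl (near_proj_lim (wprojP x)) // subrr.
Qed.

(** Test at [s = u], apply Cauchy-Schwarz and divide by [wnorm W u]. For [d <= 1] the bound is
    uniform. *)
Lemma near_proj_wnorm x u d : 0 <= d -> near_proj W V (rdot (W x)) d u ->
  wnorm W u <= wnorm W x + d.
Proof.
move=> d0 [Vu /(_ u Vu) hu].
have [->|u0] := eqVneq (wnorm W u) 0; first by rewrite addr_ge0 ?wnorm_ge0.
have {}u0 : 0 < wnorm W u by rewrite lt_def u0 wnorm_ge0.
rewrite -(ler_pM2r u0) -expr2 wnorm_sqr //.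
have := pos_CS lW W0 x u; move: hu; rewrite !ler_norml mulrDl.
by move=> /andP[_ ?] /andP[_ ?]; lra.
Qed.

(** [W (x - u)] is close to [wshort x] and almost orthogonal to [V], so [<wshort x, x>] is close to
    the nonnegative real [<W (x - u), x - u>]. Positivity, domination by [W] and maximality rest on
    this. *)
Lemma wshort_approx x (d : R) : 0 < d -> d <= 1 -> exists2 u,
    near_proj W V (rdot (W x)) d u &
    (`|rdot (wshort x) x - wnorm W (x - u) ^+ 2| <=
      d * (rnorm x + wnorm W x + 1)) /\
    `|rdot (wshort x) ('i *: x)| <= d * (rnorm x + wnorm W x + 1).
Proof.
move=> d0 d1; have [u uz pu] := wprojP x d0; exists u => //.
have [Vu hu] := pu.
have ux : wnorm W u <= wnorm W x + 1.
  by rewrite (le_trans (near_proj_wnorm (ltW d0) pu)) // lerD2l.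
have rI y : rnorm ('i *: y) = rnorm y.
  by rewrite rnormZ normc_def /= expr0n expr1n add0r sqrtr1 mul1r.
have wI y : wnorm W ('i *: y) = wnorm W y.
  by rewrite wnormZ // normc_def /= expr0n expr1n add0r sqrtr1 mul1r.
(* Used twice: [(y, v) = (x, u)] gives the real part, [(i x, i u)] the imaginary part. *)
have main y v : rnorm y = rnorm x -> wnorm W v = wnorm W u -> V v ->
    `|rdot (wshort x) y - rdot (W (x - u)) (y - v)| <=
    d * (rnorm x + wnorm W x + 1).
  move=> yx vu Vv.
  have -> : rdot (wshort x) y - rdot (W (x - u)) (y - v) =
      rdot (W u - wproj x) y - (rdot (W u) v - rdot (W x) v).
    by rewrite (linmB lW) !rdotBl !rdotBr; ring.
  rewrite (le_trans (ler_normB _ _)) // -addrA mulrDr lerD //.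
    by rewrite (le_trans (rdot_CS _ _)) // yx ler_wpM2r ?rnorm_ge0.
  by rewrite (le_trans (hu _ Vv)) // vu ler_wpM2l // ltW.
split; first by rewrite wnorm_sqr //; exact: main.
have := main ('i *: x) ('i *: u) (rI x) (wI u) (subspaceZ _ Vu).
rewrite -scalerBr.
have := W0 (x - u); rewrite inner_ge0E => /andP[/eqP-> _].
by rewrite subr0.
Qed.

Lemma wshort_pos x : 0 <= inner (wshort x) x.
Proof.
rewrite inner_ge0E; apply/andP; split.
  apply/eqP/(@eq0_small _ (rnorm x + wnorm W x + 1)) => d d0 d1.
  by have [u _ []] := wshort_approx x d0 d1.
rewrite -oppr_le0; apply: (@le0_small _ (rnorm x + wnorm W x + 1)) => d d0 d1.
have [u _ [+ _]] := wshort_approx x d0 d1; rewrite ler_norml => /andP[+ _].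
by have := sqr_ge0 (wnorm W (x - u)); lra.
Qed.

(** Testing at [s = u] gives [w(x - u) <= w(x) - w(u) + 2 d wnorm W u <= w(x) + d^2], and
    [d^2 <= d]. *)
Lemma wshort_le x : rdot (wshort x) x <= rdot (W x) x.
Proof.
rewrite -subr_le0; apply: (@le0_small _ (rnorm x + wnorm W x + 2)) => d d0 d1.
have [u [Vu hu] [+ _]] := wshort_approx x d0 d1; rewrite ler_norml => /andP[_].
have := hu u Vu; rewrite ler_norml => /andP[h1 h2].
have := sqr_ge0 (wnorm W u - d).
have dd : d ^+ 2 <= d by rewrite expr2 ler_piMr // ltW.
rewrite wnorm_sqr // (linmB lW) rdotBl !rdotBr (pos_sym lW W0 u x).
rewrite sqrrB wnorm_sqr //.
move: h1 h2 dd; lra.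
Qed.

Lemma wshort_Lpos : Lpos wshort.
Proof.
split; last exact: wshort_pos.
have [M M0 WM] := W_bound.
apply/LopP; split; first exact: wshort_linear.
exists M => //; apply: (@rnorm_pos_le wshort) => //.
- exact: wshort_linear.
- exact: wshort_pos.
- by move=> x; exact: le_trans (wshort_le x) (WM x).
Qed.

Lemma dominated_orth (X : H -> H) : Lpos X -> le_op X W ->
    range X `<=` orthocomp V ->
  forall x s, V s -> rdot (X x) x <= wnorm W (x - s) ^+ 2.
Proof.
move=> [[lX _] X0] [_ XW] XV x s Vs.
have Xs : X s = 0.
  apply: rdot_inj => y; rewrite rdotC (pos_sym lX X0).
  by rewrite [RHS]rdotC /rdot linear0l (XV _ (imageT X y) s Vs).
have := XW (x - s); rewrite inner_ge0E => /andP[_].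
rewrite rdotBl subr_ge0 wnorm_sqr // => /(le_trans _); apply.
by rewrite (linmB lX) Xs subr0 rdotBr (pos_sym lX X0) Xs /rdot linear0l subr0.
Qed.

Lemma wshort_opmax : is_opmax [set X | [/\ Lop X, le_op 0 X, le_op X W &
                                 range X `<=` orthocomp V]] wshort.
Proof.
have im0 (X : H -> H) x : (0 <= inner (X x) x) -> rdot (X x) ('i *: x) = 0.
  by rewrite inner_ge0E => /andP[/eqP].
have le_opE S T : Lpos S -> Lpos T -> 
   (forall x, rdot (S x) x <= rdot (T x) x) -> le_op S T.
  move=> [LS S0] [LT T0] ST; split; first exact: LopB.
  by move=> x; rewrite inner_ge0E !fctE !rdotBl !im0 // subrr eqxx subr_ge0 ST.
split; first split.
- exact: wshort_Lpos.1.
- by rewrite /le_op subr0; exact: wshort_Lpos.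
- exact: le_opE wshort_Lpos LW wshort_le.
- move=> _ [x _ <-] s Vs; rewrite innerE !wshort_orth //; exact: subspaceZ.
move=> X [_ + XW XV]; rewrite /le_op subr0 => X0.
apply: (le_opE _ _ X0 wshort_Lpos) => x.
rewrite -subr_le0; apply: (@le0_small _ (rnorm x + wnorm W x + 1)) => d d0 d1.
have [u [Vu _] [+ _]] := wshort_approx x d0 d1; rewrite ler_norml => /andP[+ _].
by have := dominated_orth X0 XW XV x Vu; lra.
Qed.

(** Expresses [<S x, x> = inf_{s in V} w(x - s)] for the shorted operator [S], which is how the
    theorem uses it. *)
Lemma shortedP :
  [/\ Lpos (shorted W V),
      forall x s, V s -> rdot (shorted W V x) x <= wnorm W (x - s) ^+ 2 &
      forall x e, 0 < e -> exists2 s, V s &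
        wnorm W (x - s) ^+ 2 <= rdot (shorted W V x) x + e].
Proof.
have [[_ S0 SW SV] Smax] := xgetPex 0 (ex_intro _ _ wshort_opmax).
rewrite -/(shorted W V) /le_op subr0 in S0 SW SV Smax.
split=> //; first exact: dominated_orth.
move=> x e e0; pose k := rnorm x + wnorm W x + 1.
have k1 : 1 <= k by rewrite lerDr addr_ge0 ?rnorm_ge0 ?wnorm_ge0.
have k0 : 0 < k by exact: lt_le_trans k1.
pose d := Num.min 1 (e / k).
have d0 : 0 < d by rewrite lt_min ltr01 divr_gt0.
have d1 : d <= 1 by rewrite ge_min lexx.
have dk : d * k <= e by rewrite -ler_pdivlMr // ge_min lexx orbT.
have [u [Vu _] [+ _]] := wshort_approx x d0 d1.
rewrite -/k ler_norml => /andP[ha _].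
(* Maximality puts [wshort] below the shorted operator, so a vector good for [wshort] is good
   here. *)
exists u => //; have [_ /(_ x)] := Smax _ wshort_opmax.1.
by rewrite inner_ge0E !fctE [rdot _ x]rdotBl => /andP[_]; lra.
Qed.

End Shorted.

End RealInnerProduct.

(** * Computation of the infimum *)

Theorem proposition3p1 (R : realType) (H : hilbertType R) (A B C W : H -> H)
    (sepH : separable H)
    (LA : Lop A) (closedA : closed (range A))
    (LB : Lop B) (closedB : closed (range B))
    (LC : Lop C) (LW : Lpos W)
    (NB : nullspace B `<=` nullspace (adjoint A \o W \o C)) :
  let Hf X := adjoint ((A \o X \o B) - C) \o W \o ((A \o X \o B) - C) in
  is_opinf (Hf @` Lop) (adjoint C \o shorted W (range A) \o C).
Proof.
move=> Hf; have [lA _] := LA; have [lC _] := LC; have [[lW _] W0] := LW.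
have sV : subspace (range A).
  split; first by exists 0; rewrite ?(linm0 lA).
  by move=> c _ _ [x _ <-] [y _ <-]; exists (c *: x + y); rewrite ?lA.
have [[LS S0] Sle Sapprox] := shortedP LW sV.
set S := shorted W (range A) in LS S0 Sle Sapprox *.
have adjE (T : H -> H) x y : Lop T -> inner (adjoint T x) y = inner x (T y).
  by move=> LT; rewrite innerC -(adjointP LT).2 -innerC.
have LF X : Lop X -> Lop ((A \o X \o B) - C).
  by move=> LX; exact: LopB (Lop_comp (Lop_comp LA LX) LB) LC.
have LH X : Lop X -> Lop (Hf X).
  move=> LX; have [LaF _] := adjointP (LF X LX).
  exact: Lop_comp (Lop_comp LaF LW.1) (LF X LX).
have LT : Lop (adjoint C \o S \o C).
  exact: Lop_comp (Lop_comp (adjointP LC).1 LS) LC.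
have HfE X x y : Lop X -> rdot (Hf X x) y =
    rdot (W (A (X (B x)) - C x)) (A (X (B y)) - C y).
  by move=> LX; rewrite /rdot /Hf /= adjE //; exact: LF.
have TE x y : rdot ((adjoint C \o S \o C) x) y = rdot (S (C x)) (C y).
  by rewrite /rdot /= adjE.
have Him X x : Lop X -> rdot (Hf X x) ('i%C *: x) = 0.
  move=> LX; have [lF _] := LF X LX.
  rewrite HfE //; have := linmZ lF 'i%C x; rewrite !fctE /= => ->.
  by have := W0 (A (X (B x)) - C x); rewrite inner_ge0E => /andP[/eqP].
have Tim x : rdot ((adjoint C \o S \o C) x) ('i%C *: x) = 0.
  by rewrite TE (linmZ lC); have := S0 (C x); rewrite inner_ge0E => /andP[/eqP].
split=> //.
  (* Lower bound: [A (X (B x))] is one of the vectors [s] of [R(A)]. *)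
  move=> _ [X LX <-]; split=> [|x]; first exact: LopB (LH X LX) LT.
  rewrite inner_ge0E !fctE !rdotBl Him // Tim subrr eqxx subr_ge0 /=.
  rewrite HfE // TE -(wnorm_sqr W0) -(wnormN lW) opprB.
  by apply: Sle; exists (X (B x)).
move=> D LD HD; split=> [|x]; first exact: LopB.
(* The choice [X = 0] serves twice: it forces [<D x, x>] to be real, and it settles the case
   [B x = 0]. *)
have L0 : Lop (fun=> 0 : H).
  apply/LopP; split; first by move=> c u v; rewrite scaler0 addr0.
  by exists 0 => // u; rewrite mul0r /rnorm normr0.
have Dim : rdot (D x) ('i%C *: x) = 0.
  have [_ /(_ x)] := HD _ (imageP Hf L0).
  by rewrite inner_ge0E !fctE !rdotBl Him // sub0r oppr_eq0 => /andP[/eqP].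
have Dle X : Lop X -> rdot (D x) x <= wnorm W (C x - A (X (B x))) ^+ 2.
  move=> LX; have [_ /(_ x)] := HD _ (imageP Hf LX).
  rewrite inner_ge0E !fctE !rdotBl (HfE X x x LX) subr_ge0 => /andP[_].
  by rewrite -(wnorm_sqr W0) -(wnormN lW) opprB.
have Dle_range s : range A s -> rdot (D x) x <= wnorm W (C x - s) ^+ 2.
  move=> [v _ <-]; have [Bx0|Bx0] := eqVneq (B x) 0.
    (* With the cross term zero, [w(C x - A v) = w(C x) + w(A v)], which is at least the value
       [w(C x)] reached by [X = 0]. *)
    have WCA : rdot (W (C x)) (A v) = 0.
      have /= AWC : (adjoint A \o W \o C) x = 0 by exact: NB.
      by rewrite /rdot -adjE // AWC linear0l.
    have := Dle _ L0; rewrite (linm0 lA) subr0 => /le_trans; apply.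
    rewrite (pos_expand lW W0) rdotNr WCA oppr0 mulr0 addr0 lerDl.
    exact: sqr_ge0.
  (* With [y = B x / |B x|^2], the operator [u |-> <u, y> v] sends [B x] to [v]. *)
  have := Dle _ (rank_one_Lop ((inner (B x) (B x))^-1 *: B x) v).
  have -> : inner (B x) ((inner (B x) (B x))^-1 *: B x) = 1.
    rewrite linearZr_LR /= geC0_conj ?invr_ge0 ?inner_ge0 // mulVf //.
    by rewrite dnorm_eq0.
  by rewrite scale1r.
rewrite inner_ge0E !fctE !rdotBl Tim Dim subrr eqxx TE /=.
rewrite -oppr_le0; apply: (@le0_small _ _ 1) => d d0 _.
have [s As] := Sapprox (C x) d d0.
by have := Dle_range s As; lra.
Qed.
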